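(* Let $\mathfrak{S}=(\mathcal{X},\mathsf{S},\gamma,(\Lambda_{a})_{a\in\mathcal{A}})$ be a spectral decomposition system for the Euclidean space $\mathfrak{H}$. Let $\varphi\colon\mathcal{X}\to\left]-\infty,+\infty\right]$ be a proper $\mathsf{S}$-invariant function, let $\psi\in\Gamma_0(\mathcal{X})$ be an $\mathsf{S}$-invariant Legendre function such that $\operatorname{dom}\varphi\cap\operatorname{dom}\psi\neq\varnothing$, and let $X\in\mathfrak{H}$. Then: (i) $\operatorname{env}_{\varphi\circ\gamma}^{\psi\circ\gamma}(X)=\operatorname{env}_{\varphi}^{\psi}(\gamma(X))$; (ii) for every $Z\in\mathfrak{H}$: $Z\in\operatorname{Prox}_{\varphi\circ\gamma}^{\psi\circ\gamma}X$ if and only if $\gamma(Z)\in\operatorname{Prox}_{\varphi}^{\psi}\gamma(X)$ and there exists $a\in\mathcal{A}$ with $X=\Lambda_a\gamma(X)$ and $Z=\Lambda_a\gamma(Z)$; (iii) for every $z\in\mathcal{X}$ and $a\in\mathcal{A}_X$: $\Lambda_az\in\operatorname{Prox}_{\varphi\circ\gamma}^{\psi\circ\gamma}X$ if and only if $z\in\operatorname{Prox}_{\varphi}^{\psi}\gamma(X)$; (iv) $\operatorname{Prox}_{\varphi\circ\gamma}^{\psi\circ\gamma}X=\{\Lambda_az: z\in\operatorname{Prox}_{\varphi}^{\psi}\gamma(X),\ a\in\mathcal{A}_X\}$; (v) $\operatorname{Prox}_{\varphi\circ\gamma}^{\psi\circ\gamma}X$ is convex if and only if $\operatorname{Prox}_{\varphi}^{\psi}\gamma(X)$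 is convex; (vi) $\operatorname{Prox}_{\varphi\circ\gamma}^{\psi\circ\gamma}X$ is a singleton if and only if $\operatorname{Prox}_{\varphi}^{\psi}\gamma(X)$ is a singleton.
   Context: A Euclidean space is a finite-dimensional real inner product space; inner products are written $\langle\cdot,\cdot\rangle$ and norms $\|\cdot\|$. Let $\mathfrak{H}$ and $\mathcal{X}$ be Euclidean spaces, let $\mathsf{S}$ be a group acting on $\mathcal{X}$ by linear isometries, let $\gamma\colon\mathfrak{H}\to\mathcal{X}$, and let $(\Lambda_a)_{a\in\mathcal{A}}$ be a family of linear operators from $\mathcal{X}$ to $\mathfrak{H}$. The orbit of $x$ is $\mathsf{S}\cdot x=\{s\cdot x: s\in\mathsf{S}\}$; a map $f$ on $\mathcal{X}$ is $\mathsf{S}$-invariant if $f(s\cdot x)=f(x)$ for all $s,x$. The tuple is a spectral decomposition system for $\mathfrak{H}$ if: [A] every $\Lambda_a$ is an isometry; [B] there exists an $\mathsf{S}$-invariant $\tau\colon\mathcal{X}\to\mathcal{X}$ with $\tau(x)\in\mathsf{S}\cdot x$ for all $x$ and $\gamma\circ\Lambda_a=\tau$ for all $a$; [C] for every $X\in\mathfrak{H}$ there is $a$ with $X=\Lambda_a\gamma(X)$; [D] $\langle X,Y\rangle\leq\langle\gamma(X),\gamma(Y)\rangle$ for all $X,Y\in\mathfrak{H}$. For $X\in\mathfrak{H}$, $\mathcal{A}_X=\{a\in\mathcal{A}: X=\Lambda_a\gamma(X)\}$. For functions on a Euclidean space $\mathcal{H}$: $\operatorname{dom}f=\{f<+\infty\}$;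 proper means never $-\infty$ and $\operatorname{dom}f\neq\varnothing$; $\Gamma_0(\mathcal{H})$ is the set of proper lower semicontinuous convex functions $\mathcal{H}\to\left]-\infty,+\infty\right]$; $\partial g(x)=\{u:\langle z-x,u\rangle+g(x)\leq g(z)\ \forall z\}$. A function $g\in\Gamma_0(\mathcal{H})$ is essentially smooth if $\partial g(x)$ has at most one element for every $x$, essentially strictly convex if it is strictly convex on every convex subset of $\{x:\partial g(x)\neq\varnothing\}$, and Legendre if both. ($\psi\circ\gamma$ is a Legendre function on $\mathfrak{H}$ under the stated hypotheses, so the objects below are defined.) For a Legendre $g\in\Gamma_0(\mathcal{H})$, the Bregman distance is $D_g(y,x)=g(y)-g(x)-\langle y-x,\nabla g(x)\rangle$ if $x\in\operatorname{int}\operatorname{dom}g$ and $D_g(y,x)=+\infty$ otherwise. For $f\colon\mathcal{H}\to\left]-\infty,+\infty\right]$ with $\operatorname{dom}f\cap\operatorname{dom}g\neq\varnothing$: $\operatorname{env}_f^g(x)=\inf_{y\in\mathcal{H}}(f(y)+D_g(y,x))$ and $\operatorname{Prox}_f^g x=\operatorname{Argmin}(f+D_g(\cdot,x))$, where $\operatorname{Argmin}h$ is the set of minimizers of $h$ if $\inf h<+\infty$ and $\varnothing$ otherwise. *)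

(* Defs.v *)
From HB Require Import structures.
From mathcomp Require Import all_boot all_order all_algebra.
From mathcomp Require Import boolp classical_sets reals constructive_ereal ereal.
Set Implicit Arguments. Unset Strict Implicit. Unset Printing Implicit Defensive.
Import Order.TTheory GRing.Theory Num.Theory.
Local Open Scope classical_set_scope.
Local Open Scope ring_scope.

Section Euclid.
Variable R : realType.

Record innerProd (V : vectType R) := InnerProd {
  ip :> V -> V -> R;
  ip_sym : forall x y, ip x y = ip y x;
  ip_linear : forall a x y z, ip (a *: x + y) z = a * ip x z + ip y z;
  ip_pos : forall x, x != 0 -> 0 < ip x x }.

Variable V : vectType R.
Variable ipV : innerProd V.

Definition vnorm (x : V) : R := Num.sqrt (ipV x x).

Definition interior (C : set V) : set V :=
  [set x | exists e : R, 0 < e /\ forall y, vnorm (y - x) < e -> C y].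

Definition convex_set (C : set V) : Prop :=
  forall x y (t : R), C x -> C y -> 0 <= t <= 1 -> C ((1 - t) *: x + t *: y).

Definition is_singleton (C : set V) : Prop := exists z, C = [set z].

Local Open Scope ereal_scope.

Definition effdom (f : V -> \bar R) : set V := [set x | f x < +oo].

Definition proper_fun (f : V -> \bar R) : Prop :=
  (forall x, f x != -oo) /\ effdom f !=set0.

Definition lsc (f : V -> \bar R) : Prop :=
  forall x (r : R), r%:E < f x ->
    exists e : R, (0 < e)%R /\ forall y, (vnorm (y - x)%R < e)%R -> r%:E < f y.

Definition convex_fun (f : V -> \bar R) : Prop :=
  forall (x y : V) (t : R), (0 < t < 1)%R ->
    f ((1 - t) *: x + t *: y)%R <= (1 - t)%:E * f x + t%:E * f y.

Definition strictly_convex_on (f : V -> \bar R) (C : set V) : Prop :=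
  forall (x y : V) (t : R), C x -> C y -> x != y -> (0 < t < 1)%R ->
    f ((1 - t) *: x + t *: y)%R < (1 - t)%:E * f x + t%:E * f y.

Definition Gamma0 (f : V -> \bar R) : Prop := proper_fun f /\ lsc f /\ convex_fun f.

Definition subdiff (g : V -> \bar R) (x : V) : set V :=
  [set u | forall z : V, (ipV (z - x)%R u)%:E + g x <= g z].

Definition ess_smooth (g : V -> \bar R) : Prop :=
  forall x u v, subdiff g x u -> subdiff g x v -> u = v.

Definition ess_strictly_convex (g : V -> \bar R) : Prop :=
  forall C : set V, convex_set C -> C `<=` [set x | subdiff g x !=set0] ->
    strictly_convex_on g C.

Definition Legendre (g : V -> \bar R) : Prop :=
  Gamma0 g /\ ess_smooth g /\ ess_strictly_convex g.

(* Gradient of a Legendre function at x in int effdom g: the unique element of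
   the subdifferential. *)
Definition grad (g : V -> \bar R) (x : V) : V := xget (0 : V)%R (subdiff g x).

Definition Bregman (g : V -> \bar R) (y x : V) : \bar R :=
  if `[< interior (effdom g) x >] then g y - g x - (ipV (y - x)%R (grad g x))%:E
  else +oo.

Definition env (f g : V -> \bar R) (x : V) : \bar R :=
  ereal_inf [set f y + Bregman g y x | y in [set: V]].

Definition argmin (h : V -> \bar R) : set V :=
  [set x | ereal_inf (range h) < +oo /\ forall y, h x <= h y].

Definition Prox (f g : V -> \bar R) (x : V) : set V :=
  argmin (fun y => f y + Bregman g y x).

End Euclid.

Section SDS.
Variable R : realType.

Record isomAction (X : vectType R) (ipX : innerProd X) (S : Type) := IsomAction {
  gmul : S -> S -> S;
  gone : S;
  ginv : S -> S;
  gmulA : forall s t u, gmul s (gmul t u) = gmul (gmul s t) u;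
  gmul1s : forall s, gmul gone s = s;
  gmulVs : forall s, gmul (ginv s) s = gone;
  act : S -> X -> X;
  act1 : forall x, act gone x = x;
  actM : forall s t x, act (gmul s t) x = act s (act t x);
  act_linear : forall s (a : R) x y, act s (a *: x + y) = a *: act s x + act s y;
  act_isometry : forall s x, vnorm ipX (act s x) = vnorm ipX x }.

Definition S_orbit (X : vectType R) (ipX : innerProd X) S (G : isomAction ipX S)
  (x : X) : set X := [set act G s x | s in [set: S]].

Definition S_invariant (X : vectType R) (ipX : innerProd X) S (G : isomAction ipX S)
  T (f : X -> T) : Prop := forall s x, f (act G s x) = f x.

Definition spectral_decomposition_system (H X : vectType R)
  (ipH : innerProd H) (ipX : innerProd X) S (G : isomAction ipX S)
  (gamma : H -> X) A (Lam : A -> {linear X -> H}) : Prop :=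
  [/\ (* [A] *) forall a x, vnorm ipH (Lam a x) = vnorm ipX x,
      (* [B] *) exists tau : X -> X, [/\ S_invariant G tau,
                   forall x, S_orbit G x (tau x) &
                   forall a x, gamma (Lam a x) = tau x],
      (* [C] *) forall Y : H, exists a, Y = Lam a (gamma Y) &
      (* [D] *) forall Y Z : H, ipH Y Z <= ipX (gamma Y) (gamma Z)].

Definition A_of (H X : vectType R) A (gamma : H -> X) (Lam : A -> {linear X -> H})
  (Y : H) : set A := [set a | Y = Lam a (gamma Y)].

End SDS.

(* Main.v *)
(* Write x = gamma Y.  Property [D] is an abstract trace inequality, and its
   equality case provides a common Lambda_a for the two vectors.  A subgradient u
   of psi at x satisfies tau u = u, so that grad (psi o gamma) Y = Lambda_a u for
   every a in A_Y.  Hence the objective f + D_g(., Y) takes at Lambda_a z the value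
   of the objective on X at z, and at Z at least the value of the latter at
   gamma Z: this gives (i) and (iii).  If Z is a proximal point, equality in [D]
   holds for Z and Lambda_a u, which yields b with Z = Lambda_b (gamma Z) and
   Lambda_a u = Lambda_b u; essential strict convexity of psi (injectivity of the
   gradient) upgrades the latter to b in A_Y, and (ii) and (iv) follow.

   Convexity in (v), and the upgrade above, rest on a majorization principle: if
   <m, v> <= <x, tau v> for all v, then m belongs to the convex hull (not merely
   to its closure) of the orbit of x, since orbits are compact.  Existence of u,
   for x interior to dom psi, is the finite-dimensional Hahn-Banach theorem. *)
Require Import Defs.
From HB Require Import structures.
From mathcomp Require Import all_boot all_order all_algebra.
From mathcomp Require Import boolp classical_sets reals constructive_ereal ereal.
From mathcomp Require Import topology normedtype derive.
From mathcomp Require Import ring lra.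
Set Implicit Arguments. Unset Strict Implicit. Unset Printing Implicit Defensive.
Import Order.TTheory GRing.Theory Num.Theory.
Import numFieldNormedType.Exports VectorInternalTheory.
Local Open Scope classical_set_scope.
Local Open Scope ring_scope.

(** * Inner product identities and finite convex combinations *)

Section InnerProduct.
Variables (R : realType) (V : vectType R) (ipV : innerProd V).
Implicit Types (x y z : V) (t : R).

Lemma ipDl x y z : ipV (x + y) z = ipV x z + ipV y z.
Proof. by rewrite -[x]scale1r ip_linear mul1r !scale1r. Qed.

Lemma ip0l z : ipV 0 z = 0.
Proof. by have := ipDl 0 0 z; rewrite addr0; lra. Qed.

Lemma ipZl t x z : ipV (t *: x) z = t * ipV x z.
Proof. by rewrite -[t *: x]addr0 ip_linear ip0l addr0. Qed.

Lemma ipNl x z : ipV (- x) z = - ipV x z.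
Proof. by rewrite -scaleN1r ipZl mulN1r. Qed.

Lemma ipDr x y z : ipV z (x + y) = ipV z x + ipV z y.
Proof. by rewrite ip_sym ipDl !(ip_sym _ z). Qed.

Lemma ipZr t x z : ipV z (t *: x) = t * ipV z x.
Proof. by rewrite ip_sym ipZl (ip_sym _ z). Qed.

Lemma ipNr x z : ipV z (- x) = - ipV z x.
Proof. by rewrite ip_sym ipNl (ip_sym _ z). Qed.

Definition ipE := (ipDl, ipNl, ipZl, ipDr, ipNr, ipZr).

Lemma ip_sumr I (r : seq I) (P : pred I) (F : I -> V) z :
  ipV z (\sum_(i <- r | P i) F i) = \sum_(i <- r | P i) ipV z (F i).
Proof.
elim/big_rec2: _ => [|i a b _ <-]; last exact: ipDr.
by rewrite ip_sym ip0l.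
Qed.

Lemma ip_ge0 x : 0 <= ipV x x.
Proof. by have [->|/(ip_pos ipV)/ltW//] := eqVneq x 0; rewrite ip0l. Qed.

Lemma ip_eq0 x : ipV x x <= 0 -> x = 0.
Proof. by have [->//|/(ip_pos ipV)] := eqVneq x 0; rewrite ltNge => /negbTE->. Qed.

Lemma ip_sub_eq0 x y : ipV (x - y) (x - y) <= 0 -> x = y.
Proof. by move=> /ip_eq0/eqP; rewrite subr_eq0 => /eqP. Qed.

Lemma ip_sub_scale x y t :
  ipV (x - t *: y) (x - t *: y) = ipV x x - 2 * t * ipV y x + t ^+ 2 * ipV y y.
Proof. by rewrite !ipE (ip_sym ipV x y); ring. Qed.

Lemma ip_polar x y :
  ipV x y = 2^-1 * (ipV (x + y) (x + y) - ipV x x - ipV y y).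
Proof. by rewrite !ipE (ip_sym ipV y x); lra. Qed.

Lemma vnorm_sqr x : ipV x x = vnorm ipV x ^+ 2.
Proof. by rewrite sqr_sqrtr// ip_ge0. Qed.

(** The parallelogram identity, that is, strict convexity of the norm. It later collapses to a point
    any set that is closed under midpoints and lies on a sphere. *)
Lemma midpoint_same_norm x y :
  ipV x x = ipV y y ->
  ipV x x <= ipV (2^-1 *: (x + y)) (2^-1 *: (x + y)) -> x = y.
Proof.
by move=> xy xm; apply: ip_sub_eq0; move: xm; rewrite !ipE (ip_sym ipV y x); lra.
Qed.

Lemma convex_set_sum (C : set V) n (lam : 'I_n -> R) (o : 'I_n -> V) :
  convex_set C -> (forall i, 0 <= lam i) -> \sum_i lam i = 1 ->
  (forall i, C (o i)) -> C (\sum_i lam i *: o i).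
Proof.
move=> cC; elim: n lam o => [|n IH] lam o lam0 lam1 oC.
  by move: lam1; rewrite big_ord0 => /eqP; rewrite eq_sym oner_eq0.
rewrite big_ord_recr /=; move: lam1; rewrite big_ord_recr /=.
set s := \sum_(i < n) _; set t := lam ord_max => st.
have s0 : 0 <= s by apply: sumr_ge0.
(* Normalizing the first [n] weights divides by their sum [s]; if [s] is zero, they all vanish and
   the last point carries the whole weight. *)
have [s00|sN0] := eqVneq s 0.
  rewrite big1 ?add0r; last first.
    move=> i _; have /eqP := s00; rewrite psumr_eq0// => /allP/(_ i).
    by rewrite mem_index_enum => /(_ isT)/eqP ->; rewrite scale0r.
  have -> : t = 1 by lra.
  by rewrite scale1r.
have -> : \sum_(i < n) lam (widen_ord (leqnSn n) i) *: o (widen_ord (leqnSn n) i)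
   = (1 - t) *: \sum_(i < n) (lam (widen_ord (leqnSn n) i) / s) *: o (widen_ord (leqnSn n) i).
  rewrite scaler_sumr; apply: eq_bigr => i _; rewrite scalerA; congr (_ *: _).
  by rewrite (_ : 1 - t = s); [rewrite mulrC divfK | lra].
apply: cC => //; last by have := lam0 ord_max; rewrite -/t => t0; apply/andP; split; lra.
apply: IH => [i||//]; first exact: divr_ge0.
by rewrite -mulr_suml divff.
Qed.

End InnerProduct.

(** * Carathéodory reduction of convex combinations *)

(** A 1 prepended to the coordinates turns the points into [dim V + 2] vectors of a space of
    dimension [dim V + 1], so a nontrivial relation exists; as its coefficients sum to zero, one of
    them is positive. *)
Lemma affine_dependence (R : realType) (V : vectType R)
    (o : 'I_(dim V).+2 -> V) :
  exists mu : 'I_(dim V).+2 -> R,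
    [/\ exists i, 0 < mu i, \sum_i mu i = 0 & \sum_i mu i *: o i = 0].
Proof.
pose M : 'M[R]_((dim V).+2, 1 + dim V) :=
  \matrix_i row_mx (1%:M : 'rV_1) (v2r (o i)).
have : kermx M != 0.
  rewrite -mxrank_eq0 mxrank_ker subn_eq0 -ltnNge.
  by apply: leq_ltn_trans (rank_leq_col M) _.
case/rowV0Pn => mu /sub_kermxP muM mu0.
have := muM; rewrite mulmx_sum_row.
under eq_bigr do rewrite rowK scale_row_mx.
have -> : \sum_i row_mx (mu 0 i *: (1%:M : 'rV_1)) (mu 0 i *: v2r (o i))
  = row_mx (\sum_i mu 0 i *: 1%:M) (\sum_i mu 0 i *: v2r (o i)) :> 'rV[R]_(1 + _).
  elim/big_rec3: _ => [|i a b c _ ->]; first by rewrite row_mx0.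
  by rewrite add_row_mx.
rewrite -[X in _ = X](@row_mx0 _ 1 1 (dim V)) => /eq_row_mx[mu1 muo].
have sum0 : \sum_i mu 0 i = 0.
  have := congr1 (fun A : 'rV_1 => A 0 0) mu1.
  by rewrite summxE mxE; under eq_bigr do rewrite !mxE eqxx mulr1.
exists (mu 0); split => //; last first.
  apply: v2r_inj; rewrite linear_sum linear0 -[RHS]muo.
  by apply: eq_bigr => i _; rewrite linearZ.
apply: contrapT => /forallNP nmu.
have mule i : mu 0 i <= 0 by have := nmu i; case: ltP.
move/negP: mu0; apply; apply/eqP/rowP => i; rewrite mxE.
have /eqP : \sum_i - mu 0 i = 0 by rewrite sumrN sum0 oppr0.
rewrite psumr_eq0; last by move=> j _; rewrite oppr_ge0.
by move=> /allP/(_ i); rewrite mem_index_enum oppr_eq0 => /(_ isT)/eqP.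
Qed.

(** Subtract from [lam] the multiple [lam j / mu j] of an affine dependence [mu], where [j]
    minimizes this ratio over the positive [mu j]: the weight at [j] vanishes and the others stay
    nonnegative. *)
Lemma caratheodory_step (R : realType) (V : vectType R)
    (o : 'I_(dim V).+2 -> V) (lam : 'I_(dim V).+2 -> R) :
  (forall i, 0 <= lam i) ->
  exists (j : 'I_(dim V).+2) (lam' : 'I_(dim V).+2 -> R),
    [/\ forall i, 0 <= lam' i, lam' j = 0, \sum_i lam' i = \sum_i lam i &
        \sum_i lam' i *: o i = \sum_i lam i *: o i].
Proof.
move=> lam0; have [mu [[i0 mui0] mu0 muo]] := affine_dependence o.
case: (@Order.TotalTheory.arg_minP _ _ _ i0 [pred i | 0 < mu i]
  (fun i => lam i / mu i)) => //= j muj jmin.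
exists j, (fun i => lam i - lam j / mu j * mu i); split.
- move=> i; rewrite subr_ge0; have [mui|mui] := ltP 0 (mu i).
    by rewrite -ler_pdivlMr// jmin.
  by apply: le_trans (lam0 i); rewrite mulr_ge0_le0// divr_ge0// ltW.
- by rewrite divfK ?subrr// gt_eqF.
- by rewrite sumrB -mulr_sumr mu0 mulr0 subr0.
- under eq_bigr do rewrite scalerBl -scalerA.
  by rewrite sumrB -scaler_sumr muo scaler0 subr0.
Qed.

(** * Topology of a Euclidean space through coordinate rows *)

Section Compactness.
Variables (R : realType) (V : vectType R) (ipV : innerProd V).
Local Notation W := 'rV[R]_(dim V).

(** Expanding each argument in turn along the basis leaves finite sums of products of continuous
    coordinates and constants. *)
Lemma continuous_ip (T : topologicalType) (f g : T -> W) :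
  continuous f -> continuous g ->
  continuous (fun t => ipV (r2v (f t)) (r2v (g t))).
Proof.
move=> cf cg.
have coord (h : T -> W) i : continuous h -> continuous (fun t => h t 0 i).
  move=> ch t; apply: (@continuous_comp _ _ _ h (fun M : W => M 0 i)) => //.
  - exact: ch.
  - exact: coord_continuous.
have ipc (h : T -> W) z : continuous h -> continuous (fun t => ipV z (r2v (h t))).
  move=> ch; under eq_fun do rewrite (row_sum_delta (h _)) linear_sum ip_sumr.
  apply: continuous_big; first exact: add_continuous.
  move=> i _ t; under eq_fun do rewrite linearZ ipZr.
  apply: continuousM; last exact: cst_continuous.
  exact: coord.
under eq_fun do rewrite (row_sum_delta (g _)) linear_sum ip_sumr.
apply: continuous_big; first exact: add_continuous.
move=> i _ t; under eq_fun do rewrite linearZ ipZr.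
apply: continuousM; first exact: coord.
have -> : (fun t => ipV (r2v (f t)) (r2v 'e_i)) = (fun t => ipV (r2v 'e_i) (r2v (f t))).
  by apply: funext => u; rewrite ip_sym.
exact: ipc.
Qed.

Lemma continuous_ip_diag : continuous (fun r : W => ipV (r2v r) (r2v r)).
Proof. by apply: (@continuous_ip W id id) => ?; exact: cvg_id. Qed.

Lemma closed_ip_eq (rho : R) :
  closed [set r : W | ipV (r2v r) (r2v r) = rho].
Proof.
apply: (@preimage_closed _ _ (fun r : W => ipV (r2v r) (r2v r)) [set x | x = rho]).
  by move=> r _; exact: continuous_ip_diag.
exact: closed_eq.
Qed.

(* The continuous function [ipV (r2v r) (r2v r)] has a positive minimum c on the
   unit sphere of the sup norm, so it dominates c `|r|^2 by homogeneity. *)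
Lemma compact_ip_eq (rho : R) :
  compact [set r : W | ipV (r2v r) (r2v r) = rho].
Proof.
apply: (bounded_closed_compact _ (@closed_ip_eq rho)).
pose S := [set r : W | `|r| = 1].
have cS : compact S.
  apply: bounded_closed_compact.
    exists 1; split => // x x1 r /= ->; exact: ltW.
  apply: (@preimage_closed _ _ (fun r : W => `|r|) [set x : R | x = 1]).
    by move=> r _; exact: norm_continuous.
  exact: closed_eq.
have [S0|SN0] := pselect (S !=set0); last first.
  exists 0; split => // x x0 r _ /=.
  have [->|rN0] := eqVneq r 0; first by rewrite normr0 ltW.
  exfalso; apply: SN0; exists (`|r|^-1 *: r); rewrite /S /=.
  by rewrite normrZ normfV normr_id mulVf// normr_eq0.
have [c cIS cmin] := @compact_EVT_min _ R (fun r : W => ipV (r2v r) (r2v r)) S S0 cS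
  (continuous_subspaceT continuous_ip_diag).
move: cIS; rewrite inE /S /= => c1.
have c0 : 0 < ipV (r2v c) (r2v c).
  apply: ip_pos; apply/eqP => /(congr1 v2r); rewrite r2vK linear0 => c0.
  by move: c1; rewrite c0 normr0 => /esym/eqP; rewrite oner_eq0.
set q := ipV _ _ in c0 cmin.
exists (1 + `|rho| / q); split; first exact: num_real.
move=> x xlt r /= rrho.
have [->|rN0] := eqVneq r 0.
  by rewrite normr0 (le_trans _ (ltW xlt))// addr_ge0// divr_ge0// ltW.
apply: le_trans (ltW xlt); have r0 : 0 < `|r| by rewrite normr_gt0.
have := cmin (`|r|^-1 *: r); rewrite inE /S /= normrZ normfV normr_id mulVf ?gt_eqF//.
move=> /(_ erefl); rewrite linearZ /= ipZl ipZr rrho -/q => qr.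
have rr : q * `|r| ^+ 2 <= `|rho|.
  apply: le_trans (ler_norm _); move: qr.
  by rewrite mulrA -expr2 exprVn mulrC ler_pdivlMr ?exprn_gt0.
have : `|r| ^+ 2 <= `|rho| / q by rewrite ler_pdivlMr// mulrC.
by nra.
Qed.

(** * Compactness of convex hulls and separation by a nearest point *)

Section Hull.
Variables (O : set V).

(* Pairs of the sum of the weights and the weighted sum: leaving the weights
   unnormalized makes this set an iterated continuous image of compact sets. *)
Fixpoint weighted_sums (k : nat) : set (R * W) :=
  if k is k'.+1 then
    [set (p.1.1 + p.2.1, p.1.2 + p.2.1 *: p.2.2) | p in
       weighted_sums k' `*` (`[0, 1] `*` [set r : W | O (r2v r)])]
  else [set (0, 0)].

Lemma compact_weighted_sums k :
  compact [set r : W | O (r2v r)] -> compact (weighted_sums k).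
Proof.
move=> cO; elim: k => [|k IH] /=; first exact: compact_set1.
apply: continuous_compact; last first.
  by do 2 apply: compact_setX => //; exact: segment_compact.
apply: continuous_subspaceT => p.
have c11 : {for p, continuous (fun p : (R * W) * (R * W) => p.1.1)}.
  by apply: continuous_comp; apply: cvg_fst.
have c12 : {for p, continuous (fun p : (R * W) * (R * W) => p.1.2)}.
  by apply: continuous_comp; [apply: cvg_fst | apply: cvg_snd].
have c21 : {for p, continuous (fun p : (R * W) * (R * W) => p.2.1)}.
  by apply: continuous_comp; [apply: cvg_snd | apply: cvg_fst].
have c22 : {for p, continuous (fun p : (R * W) * (R * W) => p.2.2)}.
  by apply: continuous_comp; apply: cvg_snd.
have cD : {for p, continuous (fun p : (R * W) * (R * W) => p.1.1 + p.2.1)}.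
  exact: continuousD.
have cZ : {for p, continuous (fun p : (R * W) * (R * W) => p.1.2 + p.2.1 *: p.2.2)}.
  exact: continuousD c12 (continuousZ c21 c22).
exact: cvg_pair cD cZ.
Qed.

Lemma weighted_sumsP k p :
  weighted_sums k p <-> exists (lam : 'I_k -> R) (o : 'I_k -> V),
    [/\ forall i, 0 <= lam i <= 1, forall i, O (o i) &
        p = (\sum_i lam i, v2r (\sum_i lam i *: o i))].
Proof.
elim: k p => [|k IH] p /=.
  split=> [->|[lam [o [_ _ ->]]]]; last by rewrite !big_ord0 linear0.
  by exists (fun=> 0), (fun=> 0); split=> [[]|[]|] //; rewrite !big_ord0 linear0.
split.
  move=> [[q [t r]] [/= /IH[lam [o [lam01 oO ->]]] [/= t01 rO]] <-] /=.
  move: t01; rewrite in_itv /= => t01.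
  exists (fun i => if unlift ord_max i is Some j then lam j else t),
         (fun i => if unlift ord_max i is Some j then o j else r2v r).
  split=> [i|i|]; try by case: unliftP.
  have wl (i : 'I_k) : widen_ord (leqnSn k) i = lift ord_max i.
    by apply: val_inj; rewrite /= /bump leqNgt ltn_ord.
  rewrite !big_ord_recr /= unlift_none linearD linearZ /= r2vK.
  by congr (_ + _, v2r _ + _); apply: eq_bigr => i _; rewrite wl liftK.
move=> [lam [o [lam01 oO ->]]].
exists ((\sum_(i < k) lam (widen_ord (leqnSn k) i),
         v2r (\sum_(i < k) lam (widen_ord (leqnSn k) i) *: o (widen_ord (leqnSn k) i))),
        (lam ord_max, v2r (o ord_max))).
  split=> /=; last by rewrite v2rK in_itv /=.
  by apply/IH; do 2 eexists; split; last reflexivity.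
by rewrite /= !big_ord_recr linearD linearZ.
Qed.

(* Carathéodory's theorem makes the convex hull of a compact set compact, so a
   point k of it is nearest to m; moving from k towards a point of O that is
   at least as far as m in the direction m - k would come nearer. *)
Lemma mem_convex_hull (m : V) (C : set V) :
  compact [set r : W | O (r2v r)] ->
  (forall v, exists2 o, O o & ipV m v <= ipV o v) ->
  convex_set C -> O `<=` C -> C m.
Proof.
move=> cO mO cC OC; pose d (p : R * W) := ipV (m - r2v p.2) (m - r2v p.2).
(* Normalization of the weights enters only here, as a closed condition; [dim V + 1] terms suffice
   by Carathéodory's theorem. *)
pose K := weighted_sums (dim V).+1 `&` [set p | p.1 = 1].
have cK : compact K.
  apply: compact_closedI; first exact: compact_weighted_sums.
  apply: (@preimage_closed _ _ fst [set x : R | x = 1]); last exact: closed_eq.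
  by move=> p _; exact: cvg_fst.
have K0 : K !=set0.
  have [o Oo _] := mO 0.
  exists (1, v2r o); split => //; apply/weighted_sumsP.
  exists (fun i => (i == ord0)%:R), (fun=> o); split => // [i|].
    by case: (i == _); rewrite /= ?lexx ?ler01.
  by rewrite !big_ord_recl /= !big1 ?addr0 ?scale1r// => i _; rewrite ?scale0r.
have cd : continuous d.
  have -> : d = fun p => ipV (r2v (v2r m - p.2)) (r2v (v2r m - p.2)).
    by apply: funext => p; rewrite linearB /= v2rK.
  have c2 : continuous (fun p : R * W => v2r m - p.2).
    by move=> p; apply: continuousB; [exact: cst_continuous | exact: cvg_snd].
  exact: continuous_ip.
have [[s k] /set_mem[/weighted_sumsP[lam [o [lam01 oO [-> ->]]]] /= lam1] kmin] :=
  compact_EVT_min K0 cK (continuous_subspaceT cd).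
set y := \sum_i lam i *: o i in kmin.
have dy : d (\sum_i lam i, v2r y) = ipV (m - y) (m - y) by rewrite /d /= v2rK.
suff -> : m = y by apply: convex_set_sum => // i; [case/andP: (lam01 i)|exact: OC].
have [o' Oo' mo'] := mO (m - y).
(* The point [y + t *: (o' - y)] combines [dim V + 2] points of [O]; [caratheodory_step] drops one
   of them, so the point is represented in [K] and is no nearer to [m] than [y]. *)
have step t : 0 <= t <= 1 ->
    ipV (m - y) (m - y) <= ipV (m - (y + t *: (o' - y))) (m - (y + t *: (o' - y))).
  move=> t01.
  pose o2 i := if unlift ord0 i is Some j then o j else o'.
  pose l2 i := if unlift ord0 i is Some j then (1 - t) * lam j else t.
  have l20 i : 0 <= l2 i.
    rewrite /l2; case: unliftP => [j _|_]; last by case/andP: t01.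
    by have /andP[? ?] := lam01 j; apply: mulr_ge0 => //; lra.
  have [j [l3 [l30 l3j l3s l3o]]] := caratheodory_step o2 l20.
  have l2s : \sum_i l2 i = 1.
    rewrite big_ord_recl /l2 unlift_none; under eq_bigr do rewrite liftK.
    by rewrite -mulr_sumr lam1; lra.
  have l2o : \sum_i l2 i *: o2 i = y + t *: (o' - y).
    rewrite big_ord_recl /l2 /o2 unlift_none; under eq_bigr do rewrite liftK -scalerA.
    by rewrite -scaler_sumr -/y scalerBl scale1r scalerBr addrC addrAC addrA.
  have l3s' : \sum_i l3 (lift j i) = 1.
    by rewrite -l2s -l3s (bigD1_ord j) //= l3j add0r.
  have l3o' : \sum_i l3 (lift j i) *: o2 (lift j i) = y + t *: (o' - y).
    by rewrite -l2o -l3o [RHS](bigD1_ord j) //= l3j scale0r add0r.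
  have : (1, v2r (y + t *: (o' - y))) \in K.
    rewrite inE; split => //; apply/weighted_sumsP.
    exists (fun i => l3 (lift j i)), (fun i => o2 (lift j i)); split.
    - move=> i; rewrite l30 /= -l3s' (bigD1 i) //= lerDl.
      by apply: sumr_ge0.
    - by move=> i; rewrite /o2; case: unliftP.
    - by rewrite l3s' l3o'.
  by move=> /kmin; rewrite dy /d /= v2rK.
apply: ip_sub_eq0; rewrite leNgt; apply/negP => D0.
pose D := ipV (m - y) (m - y); pose Q := ipV (o' - y) (o' - y).
have Q0 : 0 <= Q by exact: ip_ge0.
have e : ipV (m - y) (m - y) <= ipV (o' - y) (m - y) by rewrite !(ipDl _ _ (- y)) lerD2r.
have DQ : 0 < D + Q by rewrite /D; lra.
(* With E the inner product of [o' - y] and [m - y], this value of t gives t Q = D - t D < D <= E,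
   so the new squared distance D - 2 t E + t^2 Q falls below D. *)
have t0 : 0 < D / (D + Q) by exact: divr_gt0.
have t1 : D / (D + Q) <= 1 by rewrite ler_pdivrMr// mul1r lerDl.
have := step (D / (D + Q)); rewrite (ltW t0) t1 => /(_ isT).
set t := D / (D + Q) in t0 t1 *.
have -> : m - (y + t *: (o' - y)) = (m - y) - t *: (o' - y) by rewrite opprD addrA.
rewrite ip_sub_scale.
move: e; rewrite -/D -/Q; set E := ipV (o' - y) (m - y) => e h.
have tDQ : t * (D + Q) = D by rewrite /t divfK// gt_eqF.
have : t * (2 * E - t * Q) <= 0 by lra.
rewrite pmulr_rle0// => h2.
have tQ : t * Q = D - t * D by lra.
have tD : 0 < t * D by rewrite mulr_gt0.
by move: D0; rewrite -/D; lra.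
Qed.

End Hull.
End Compactness.

(** * The finite-dimensional Hahn-Banach theorem in coordinates *)

Definition dot (R : realType) n (c r : 'rV[R]_n) : R := \sum_i c 0 i * r 0 i.

Section HahnBanach.
Variables (R : realType) (n : nat) (g : 'rV[R]_n -> \bar R).

Lemma dotDl (a b r : 'rV[R]_n) : dot (a + b) r = dot a r + dot b r.
Proof. by rewrite -big_split; apply: eq_bigr => i _; rewrite mxE mulrDl. Qed.

Lemma dotDr (a b r : 'rV[R]_n) : dot r (a + b) = dot r a + dot r b.
Proof. by rewrite -big_split; apply: eq_bigr => i _; rewrite mxE mulrDr. Qed.

Lemma dotZr (t : R) (a r : 'rV[R]_n) : dot r (t *: a) = t * dot r a.
Proof. by rewrite mulr_sumr; apply: eq_bigr => i _; rewrite mxE mulrCA. Qed.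

Lemma dot_delta (d : R) k (r : 'rV[R]_n) : dot (d *: 'e_k) r = d * r 0 k.
Proof.
rewrite /dot (bigD1 k) //= big1 ?addr0; first by rewrite !mxE !eqxx mulr1.
by move=> i /negbTE ik; rewrite !mxE ik /= mulr0 mul0r.
Qed.

Hypothesis g0 : g 0 = 0%E.
Hypothesis gNoo : forall r, g r != -oo%E.
Hypothesis gconv : forall x y (t : R), 0 < t < 1 ->
  (g ((1 - t) *: x + t *: y) <= (1 - t)%:E * g x + t%:E * g y)%E.
Hypothesis gfin : forall k : 'I_n, exists t : R,
  [/\ 0 < t, (g (t *: 'e_k) < +oo)%E & (g (- t *: 'e_k) < +oo)%E].

(* One coordinate at a time: convexity keeps the lower bounds A on the k-th
   coefficient below the upper bounds, and sup A lies between them. *)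
Lemma linear_minorant : exists c : 'rV[R]_n, forall r, ((dot c r)%:E <= g r)%E.
Proof.
(* The minorant is extended along the increasing chain of subspaces spanned by the first [k] basis
   vectors. *)
pose supp k (r : 'rV[R]_n) := forall i : 'I_n, (k <= i)%N -> r 0 i = 0.
suff H k : (k <= n)%N -> exists c : 'rV[R]_n, forall r, supp k r -> ((dot c r)%:E <= g r)%E.
  have [c hc] := H n (leqnn n).
  by exists c => r; apply: hc => i; rewrite leqNgt ltn_ord.
elim: k => [_|k IH kn].
  exists 0 => r r0; have -> : r = 0 by apply/rowP => i; rewrite mxE r0.
  by rewrite g0 /dot big1// => i _; rewrite mxE mul0r.
have [c hc] := IH (ltnW kn); pose K := Ordinal kn.
have fin r : (g r < +oo)%E -> exists y, g r = y%:E.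
  by case: (g r) (gNoo r) => // y _ _; exists y.
have suppe t : supp k.+1 (t *: 'e_K).
  by move=> i ki; rewrite !mxE eqxx /= -val_eqE /= gtn_eqF ?mulr0.
pose A := [set a | exists r y, [/\ supp k.+1 r, r 0 K < 0, g r = y%:E & a = (y - dot c r) / r 0 K]].
have AB r' y' a : supp k.+1 r' -> 0 < r' 0 K -> g r' = y'%:E -> A a ->
    a <= (y' - dot c r') / r' 0 K.
  move=> sr' r'K gr' [r [y [sr rK gr ->]]].
  set t := r' 0 K in r'K *; set s := - r 0 K.
  have s0 : 0 < s by rewrite oppr_gt0.
  have -> : r 0 K = - s by rewrite opprK.
  have st : 0 < s + t by exact: addr_gt0.
  (* At this weight the segment from [r] to [r'] crosses the hyperplane where the [K]-th coordinate
     vanishes, and there the induction hypothesis applies. *)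
  pose q := s / (s + t).
  have q01 : 0 < q < 1 by rewrite divr_gt0//= ltr_pdivrMr// mul1r ltrDl.
  have z0 : supp k ((1 - q) *: r + q *: r').
    move=> i; rewrite leq_eqVlt => /predU1P[ki|ki]; last first.
      by rewrite !mxE sr// sr'// !mulr0 addr0.
    have -> : i = K by apply: val_inj.
    rewrite !mxE -/t; have -> : r 0 K = - s by rewrite opprK.
    by rewrite /q; field; rewrite gt_eqF.
  have := le_trans (hc _ z0) (gconv r r' q01).
  rewrite gr gr' -!EFinM -EFinD lee_fin dotDr !dotZr => h.
  rewrite invrN mulrN -mulNr ler_pdivrMr// mulrAC ler_pdivlMr//.
  have sq : q * (s + t) = s by rewrite /q divfK// gt_eqF.
  have h2 : 0 <= ((1 - q) * (y - dot c r) + q * (y' - dot c r')) * (s + t).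
    by apply: mulr_ge0; [lra|exact: ltW].
  have -> : (y' - dot c r') * s = q * (s + t) * (y' - dot c r') by rewrite sq; ring.
  have tq : (1 - q) * (s + t) = t by rewrite mulrBl sq; ring.
  have -> : - (y - dot c r) * t = - ((1 - q) * (s + t) * (y - dot c r)) by rewrite tq; ring.
  by lra.
have [t [t0 /fin[y1 gp] /fin[y2 gm]]] := gfin K.
have eK (d : R) : (d *: 'e_K : 'rV[R]_n) 0 K = d by rewrite !mxE !eqxx mulr1.
(* By [gfin], [g] is finite at a point on each side of that hyperplane: the negative one makes [A]
   nonempty, the positive one bounds it above. *)
have supA : has_sup A.
  split; first by eexists; exists (- t *: 'e_K), y2; split; rewrite ?eK ?oppr_lt0.
  by eexists => a; apply: AB (suppe t) _ gp; rewrite eK.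
exists (c + sup A *: 'e_K) => r sr; rewrite dotDl dot_delta.
have [|/fin[y gr]] := leP +oo%E (g r); first by rewrite leye_eq => /eqP ->; rewrite leey.
rewrite gr lee_fin.
have [rK|rK|rK] := ltgtP (r 0 K) 0.
- have : (y - dot c r) / r 0 K <= sup A by apply: (ub_le_sup supA.2); exists r, y.
  by rewrite ler_ndivrMr//; lra.
- have : sup A <= (y - dot c r) / r 0 K by apply: (ge_sup supA.1) => a; exact: AB.
  by rewrite ler_pdivlMr//; lra.
- rewrite rK mulr0 addr0 -lee_fin -gr; apply: hc => i; rewrite leq_eqVlt.
  by move=> /predU1P[ki|/sr//]; have -> : i = K by apply: val_inj.
Qed.

End HahnBanach.

(** * Existence of subgradients at interior points *)

Section Subgradient.
Variables (R : realType) (V : vectType R) (ipV : innerProd V).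

(** The Gram matrix of the basis is invertible: a row in its kernel represents a vector orthogonal
    to the whole basis, hence to itself. *)
Lemma riesz (c : 'rV[R]_(dim V)) :
  exists u : V, forall v, ipV v u = dot c (v2r v).
Proof.
pose G : 'M[R]_(dim V) := \matrix_(i, j) ipV (r2v 'e_i) (r2v 'e_j).
have ipG (q : 'rV_(dim V)) j : ipV (r2v 'e_j) (r2v q) = (q *m G) 0 j.
  rewrite [in LHS](row_sum_delta q) linear_sum ip_sumr mxE.
  by apply: eq_bigr => i _; rewrite linearZ ipZr mxE (ip_sym ipV (r2v 'e_j)).
have ipd (u v : V) : ipV v u = \sum_j v2r v 0 j * ipV (r2v 'e_j) u.
  rewrite -[in LHS](v2rK v) [in LHS](row_sum_delta (v2r v)) linear_sum ip_sym ip_sumr.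
  by apply: eq_bigr => i _; rewrite linearZ ipZr (ip_sym ipV u).
have uG : G \in unitmx.
  rewrite -row_free_unit -kermx_eq0; apply/eqP/row_matrixP => i; rewrite row0.
  have := mulmx_ker G; move/(congr1 (row i)); rewrite row_mul row0.
  move: (row i _) => q qG.
  rewrite -[q]r2vK (@ip_eq0 _ _ ipV (r2v q)) ?linear0//.
  rewrite ipd big1// => j _; rewrite ipG qG mxE mulr0//.
exists (r2v (c *m invmx G)) => v; rewrite ipd /dot; apply: eq_bigr => i _.
by rewrite ipG mulmxKV// mulrC.
Qed.

(** A linear minorant of [f] recentered at [x], represented through [riesz], is a subgradient.
    Interiority gives finite values on both sides of [x] along every axis. *)
Lemma subdiff_interior (f : V -> \bar R) x :
  proper_fun f -> convex_fun f -> Defs.interior ipV (effdom f) x ->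
  subdiff ipV f x !=set0.
Proof.
move=> [fNoo _] cf [e [e0 xe]].
have xx : effdom f x by apply: xe; rewrite subrr /vnorm ip0l sqrtr0.
have [r fx] : exists r, f x = r%:E.
  by move: xx (fNoo x); rewrite /effdom /=; case: (f x) => // r _ _; exists r.
pose g (q : 'rV_(dim V)) := (f (x + r2v q)%R - r%:E)%E.
have [] := @linear_minorant R (dim V) g.
- by rewrite /g linear0 addr0 fx subee.
- by move=> q; rewrite /g; case: (f _) (fNoo (x + r2v q)).
- move=> q1 q2 t t01; rewrite /g linearD !linearZ /=.
  have -> : x + ((1 - t) *: r2v q1 + t *: r2v q2) =
    (1 - t) *: (x + r2v q1) + t *: (x + r2v q2).
    rewrite !scalerDr addrACA -scalerDl; congr (_ + _).
    by rewrite (_ : 1 - t + t = 1) ?scale1r//; ring.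
  have /andP[t0 t1] := t01; have t1' : 0 < 1 - t by lra.
  have := cf (x + r2v q1) (x + r2v q2) t t01.
  move: (f _) (fNoo ((1 - t) *: (x + r2v q1) + t *: (x + r2v q2))) => a aN.
  move: (f _) (fNoo (x + r2v q1)) => b bN; move: (f _) (fNoo (x + r2v q2)) => d dN.
  case: b bN => // [b|] _; case: d dN => // [d|] _;
    rewrite /= ?gt0_muley ?lte_fin//= ?leey //.
  by case: a aN => // a _; rewrite -?EFinM -?EFinD !lee_fin; lra.
- move=> k; pose N := vnorm ipV (r2v 'e_k).
  have N0 : 0 <= N by exact: sqrtr_ge0.
  have vn (t : R) : vnorm ipV (t *: r2v 'e_k) = `|t| * N.
    by rewrite /vnorm ipZl ipZr mulrA -expr2 sqrtrM ?sqr_ge0// sqrtr_sqr.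
  pose t := e / (1 + N); have N1 : 0 < 1 + N by lra.
  have t0 : 0 < t by exact: divr_gt0.
  have tN : t * N < e by rewrite /t mulrAC ltr_pdivrMr// mulrDr mulr1 ltrDr.
  have fin (s : R) : `|s| = t -> (g (s *: 'e_k) < +oo)%E.
    move=> st; have : effdom f (x + s *: r2v 'e_k).
      by apply: xe; rewrite addrC addKr vn st.
    by rewrite /effdom /g /= linearZ /=; case: (f _) => //= y _; exact: ltry.
  by exists t; split => //; apply: fin; rewrite ?normrN gtr0_norm.
- move=> c hc; have [u uc] := riesz c; exists u => z.
  have := hc (v2r (z - x)); rewrite -uc /g v2rK (addrC x) subrK fx.
  case: (f z) (fNoo z) => // [s|] _ h; last by rewrite leey.
  by move: h; rewrite -EFinD !lee_fin; lra.
Qed.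

End Subgradient.

(** * Injectivity of the subdifferential under essential strict convexity *)

Section EssentiallyStrictlyConvex.
Variables (R : realType) (V : vectType R) (ipV : innerProd V).
Variable (f : V -> \bar R).
Hypothesis fNoo : forall x, f x != -oo%E.
Hypothesis f_convex : convex_fun f.

Lemma fin_of_lty x : (f x < +oo)%E -> exists r, f x = r%:E.
Proof. by case: (f x) (fNoo x) => // r _ _; exists r. Qed.

Lemma convex_sublevel (r : R) : convex_set [set x | (f x <= r%:E)%E].
Proof.
move=> x y t /= fx fy /andP[t0 t1].
have [->|tN0] := eqVneq t 0; first by rewrite subr0 scale1r scale0r addr0.
have [->|tN1] := eqVneq t 1; first by rewrite subrr scale1r scale0r add0r.
have t0' : 0 < t by rewrite lt_neqAle eq_sym tN0.
have t1' : t < 1 by rewrite lt_neqAle tN1.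
apply: le_trans (f_convex _ _ _) _; first by rewrite t0' t1'.
have [a fa] := fin_of_lty (le_lt_trans fx (ltry r)).
have [b fb] := fin_of_lty (le_lt_trans fy (ltry r)).
by move: fx fy; rewrite fa fb -!EFinM -EFinD !lee_fin; nra.
Qed.

Hypothesis f_esc : ess_strictly_convex ipV f.

(* The points with subgradient u form a convex set, on which f is affine. *)
Lemma subdiff_inj x y u (a : R) : f x = a%:E ->
  subdiff ipV f x u -> subdiff ipV f y u -> x = y.
Proof.
move=> fx xu yu.
have fin z : subdiff ipV f z u -> exists r, f z = r%:E.
  move=> zu; apply: fin_of_lty.
  by have := zu x; rewrite fx; case: (f z) => //= *; exact: ltry.
pose C := [set z | subdiff ipV f z u].
have cC : convex_set C.
  move=> z1 z2 t z1u z2u /andP[t0 t1].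
  have [->|tN0] := eqVneq t 0; first by rewrite subr0 scale1r scale0r addr0.
  have [->|tN1] := eqVneq t 1; first by rewrite subrr scale1r scale0r add0r.
  have t0' : 0 < t by rewrite lt_neqAle eq_sym tN0.
  have t1' : t < 1 by rewrite lt_neqAle tN1.
  have [r1 fz1] := fin _ z1u; have [r2 fz2] := fin _ z2u => z.
  have t01 : 0 < t < 1 by rewrite t0' t1'.
  have := f_convex z1 z2 t01; rewrite fz1 fz2 -!EFinM -EFinD.
  have := z1u z; have := z2u z; rewrite fz1 fz2.
  case: (f z) (fNoo z) => // [r|] _; last by move=> *; exact: leey.
  case: (f (_ + _)) (fNoo ((1 - t) *: z1 + t *: z2)) => //= s _.
  by rewrite -!EFinD !lee_fin !ipE; nra.
have [//|xy] := eqVneq x y.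
have Csub : C `<=` [set z | subdiff ipV f z !=set0] by move=> z zu; exists u.
(* The average of the two subgradient inequalities at the midpoint bounds [f] there from below by
   the mean of its end values, against strict convexity. *)
have h01 : 0 < (2^-1 : R) < 1 by lra.
have := f_esc cC Csub xu yu xy h01.
have [b fy] := fin _ yu; have := xu ((1 - 2^-1) *: x + 2^-1 *: y).
have := yu ((1 - 2^-1) *: x + 2^-1 *: y).
rewrite fx fy -!EFinM -EFinD.
case: (f (_ + _)) (fNoo ((1 - 2^-1) *: x + 2^-1 *: y)) => //= r _; rewrite -!EFinD !lee_fin lte_fin !ipE.
by move=> h1 h2 h3; exfalso; move: h1 h2 h3; clear; lra.
Qed.

End EssentiallyStrictlyConvex.

(** * Spectral decomposition systems: trace inequality, orbits, majorization *)

Section SpectralDecomposition.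
Variables (R : realType) (H X : vectType R).
Variables (ipH : innerProd H) (ipX : innerProd X) (S : Type) (G : isomAction ipX S).
Variables (gamma : H -> X) (A : Type) (Lam : A -> {linear X -> H}) (tau : X -> X).
Hypothesis Lam_vnorm : forall a x, vnorm ipH (Lam a x) = vnorm ipX x.
Hypothesis tau_inv : S_invariant G tau.
Hypothesis tau_orbit : forall x, S_orbit G x (tau x).
Hypothesis gamma_Lam : forall a x, gamma (Lam a x) = tau x.
Hypothesis Lam_gamma : forall Y : H, exists a, Y = Lam a (gamma Y).
Hypothesis ip_gamma : forall Y Z : H, ipH Y Z <= ipX (gamma Y) (gamma Z).

Lemma ip_Lam a x y : ipH (Lam a x) (Lam a y) = ipX x y.
Proof. by rewrite ip_polar [RHS]ip_polar -linearD !vnorm_sqr !Lam_vnorm. Qed.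

Lemma actD s x y : act G s (x + y) = act G s x + act G s y.
Proof. by have := act_linear G s 1 x y; rewrite !scale1r. Qed.

Lemma ip_act s x y : ipX (act G s x) (act G s y) = ipX x y.
Proof. by rewrite ip_polar [RHS]ip_polar -actD !vnorm_sqr !act_isometry. Qed.

Lemma actK s x : act G (ginv G s) (act G s x) = x.
Proof. by rewrite -actM gmulVs act1. Qed.

Lemma ip_act_adj s x y : ipX x (act G s y) = ipX (act G (ginv G s) x) y.
Proof. by rewrite -(ip_act (ginv G s)) actK. Qed.

Lemma tau_gamma Y : tau (gamma Y) = gamma Y.
Proof. by have [a YE] := Lam_gamma Y; rewrite [RHS](congr1 gamma YE) gamma_Lam. Qed.

Lemma ip_gamma_diag Y : ipX (gamma Y) (gamma Y) = ipH Y Y.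
Proof. by have [a YE] := Lam_gamma Y; rewrite [in RHS]YE ip_Lam. Qed.

Lemma ip_tau_diag x : ipX (tau x) (tau x) = ipX x x.
Proof. by have [s _ <-] := tau_orbit x; rewrite ip_act. Qed.

(** An abstract rearrangement inequality: carry both vectors to [H] by any one [Lam a] and apply
    [D]. The decomposition of 0 only supplies an index [a]. *)
Lemma ip_tau x y : ipX x y <= ipX (tau x) (tau y).
Proof.
have [a _] := Lam_gamma 0; rewrite -(ip_Lam a).
by apply: le_trans (ip_gamma _ _) _; rewrite !gamma_Lam.
Qed.

Lemma ip_Lam_le a Z u : ipH Z (Lam a u) <= ipX (gamma Z) (tau u).
Proof. by apply: le_trans (ip_gamma _ _) _; rewrite gamma_Lam. Qed.

Lemma tau_eq_orbit x y : tau y = tau x -> S_orbit G x y.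
Proof.
have [s _ sy] := tau_orbit y; have [t _ tx] := tau_orbit x => tyx.
exists (gmul G (ginv G s) t) => //.
by rewrite actM tx -tyx -sy actK.
Qed.

(* Both inequalities in <Y, Y + U> <= <gamma Y, gamma (Y + U)> and its analogue
   for U are equalities, which forces gamma (Y + U) = gamma Y + gamma U; any a
   that diagonalizes Y + U then diagonalizes both. *)
Lemma simultaneous_decomposition Y U :
  ipH Y U = ipX (gamma Y) (gamma U) ->
  exists a, Y = Lam a (gamma Y) /\ U = Lam a (gamma U).
Proof.
move=> YU; have gYU : gamma (Y + U) = gamma Y + gamma U.
  apply: (@ip_sub_eq0 _ _ ipX).
  have := ip_gamma Y (Y + U); have := ip_gamma U (Y + U).
  have := ip_gamma_diag (Y + U); have := ip_gamma_diag Y; have := ip_gamma_diag U.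
  move: YU; rewrite !ipE (ip_sym ipH U Y) (ip_sym ipX (gamma U) (gamma Y)).
  rewrite !(ip_sym ipX (gamma (Y + U))).
  by lra.
have [a aYU] := Lam_gamma (Y + U); exists a.
move: aYU; rewrite gYU linearD => aYU.
have YYE : ipH Y (Y + U) = ipH Y (Lam a (gamma Y)) + ipH Y (Lam a (gamma U)).
  by rewrite aYU ipDr.
have UUE : ipH U (Y + U) = ipH U (Lam a (gamma Y)) + ipH U (Lam a (gamma U)).
  by rewrite aYU ipDr.
have := ip_Lam_le a Y (gamma Y); have := ip_Lam_le a Y (gamma U).
have := ip_Lam_le a U (gamma Y); have := ip_Lam_le a U (gamma U).
have aa := ip_Lam a; have gY := ip_gamma_diag Y; have gU := ip_gamma_diag U.
rewrite !tau_gamma => UU' UY' YU' YY'.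
move: YYE UUE; rewrite !ipDr (ip_sym ipH U Y) YU => YYE UUE.
rewrite (ip_sym ipX (gamma U) (gamma Y)) in UY'.
split; apply: (@ip_sub_eq0 _ _ ipH); rewrite !ipE aa (ip_sym ipH (Lam a _)); lra.
Qed.

(** No topology on [S] is involved: the orbit is cut out of a sphere by closed half-spaces. Testing
    [r] against itself forces [tau r = tau x], by equality of norms. *)
Lemma compact_orbit x :
  compact [set r : 'rV[R]_(dim X) | S_orbit G x (r2v r)].
Proof.
have -> : [set r : 'rV[R]_(dim X) | S_orbit G x (r2v r)] =
    [set r | ipX (r2v r) (r2v r) = ipX x x] `&`
    \bigcap_v [set r | ipX (r2v r) v <= ipX (tau x) (tau v)].
  apply/seteqP; split=> [r [s _ sr]|r [/= rx rtau]] /=.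
    split=> [|v _] /=; first by rewrite -sr ip_act.
    by apply: le_trans (ip_tau _ _) _; rewrite -sr tau_inv.
  apply: tau_eq_orbit; apply: (@ip_sub_eq0 _ _ ipX).
  have := rtau (r2v r) I; rewrite /= !ipE !ip_tau_diag (ip_sym ipX (tau (r2v r))) rx; lra.
apply: compact_closedI (@compact_ip_eq _ _ ipX _) _.
apply: closed_bigI => v _.
apply: (@preimage_closed _ _ (fun r : 'rV[R]_(dim X) => ipX (r2v r) v)
  [set t | t <= ipX (tau x) (tau v)]); last exact: closed_le.
move=> r _; rewrite -[v]v2rK.
apply: (@continuous_ip _ _ ipX _ id (fun=> v2r v)) => [?|?]; first exact: cvg_id.
exact: cst_continuous.
Qed.

(** If [s] carries [v] to [tau v], then its inverse carries [x] to an orbit point whose inner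
    product with [v] is that of [x] with [tau v]. Hence no direction separates [m] from the
    orbit. *)
Lemma majorized_mem x m (C : set X) :
  (forall v, ipX m v <= ipX x (tau v)) -> convex_set C ->
  (forall s, C (act G s x)) -> C m.
Proof.
move=> mx cC xC; apply: (@mem_convex_hull _ _ ipX (S_orbit G x)) => //.
- exact: compact_orbit.
- move=> v; have [s _ sv] := tau_orbit v.
  exists (act G (ginv G s) x); first by exists (ginv G s).
  by rewrite -ip_act_adj sv.
- by move=> _ [s _ <-].
Qed.

(** * Subgradients and Bregman distances of spectral functions *)

Section Legendre.
Variable psi : X -> \bar R.
Hypothesis psi_inv : S_invariant G psi.
Hypothesis psi_proper : proper_fun psi.
Hypothesis psi_convex : convex_fun psi.
Hypothesis psi_smooth : ess_smooth ipX psi.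
Hypothesis psi_esc : ess_strictly_convex ipX psi.

Lemma psi_tau x : psi (tau x) = psi x.
Proof. by have [s _ <-] := tau_orbit x; rewrite psi_inv. Qed.

Lemma psi_gamma_Lam a x : psi (gamma (Lam a x)) = psi x.
Proof. by rewrite gamma_Lam psi_tau. Qed.

(** Moving test points along the orbit and [ip_tau] show that [u] and [tau u] have the same inner
    product with [x]. Then [tau u] is a subgradient at [x] too, and essential smoothness identifies
    the two. *)
Lemma tau_subgradient x u (r : R) :
  tau x = x -> psi x = r%:E -> subdiff ipX psi x u -> tau u = u.
Proof.
move=> tx fx xu; have [s _ su] := tau_orbit u.
have le1 : ipX x (tau u) <= ipX x u.
  have := xu (act G (ginv G s) x); rewrite psi_inv fx -EFinD lee_fin !ipE.
  by rewrite -ip_act_adj su; lra.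
have le2 := ip_tau x u; rewrite tx in le2.
apply: (psi_smooth _ xu) => z.
have := xu (act G (ginv G s) z); rewrite psi_inv !ipE -su.
by rewrite -ip_act_adj su (_ : ipX x (tau u) = ipX x u)//; lra.
Qed.

Section AtPoint.
Variables (Y : H) (r : R).
Hypothesis psiY : psi (gamma Y) = r%:E.

(** With [b] a decomposition of [U], the test point [Lam b (gamma Y)] has the same value as [Y] and
    gives equality in [D]; the test points [Lam b z] then give the subgradient inequality on [X]. *)
Lemma subdiff_gamma U : subdiff ipH (psi \o gamma) Y U ->
  subdiff ipX psi (gamma Y) (gamma U) /\ ipH Y U = ipX (gamma Y) (gamma U).
Proof.
move=> YU; have [b UE] := Lam_gamma U.
have bU z : ipH (Lam b z) U = ipX z (gamma U) by rewrite {1}UE ip_Lam.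
have YUE : ipH Y U = ipX (gamma Y) (gamma U).
  apply/le_anti; rewrite ip_gamma /=.
  have := YU (Lam b (gamma Y)); rewrite /= psi_gamma_Lam psiY -EFinD lee_fin.
  by rewrite !ipE bU; lra.
split => // z; have := YU (Lam b z); rewrite /= psi_gamma_Lam.
by rewrite !ipDl !ipNl bU YUE.
Qed.

Lemma subdiff_Lam a u : A_of gamma Lam Y a -> subdiff ipX psi (gamma Y) u ->
  subdiff ipH (psi \o gamma) Y (Lam a u).
Proof.
move=> aY xu Z; have tu := tau_subgradient (tau_gamma Y) psiY xu.
apply: le_trans (xu (gamma Z)) => /=; rewrite psiY -!EFinD lee_fin lerD2r.
have YL : ipH Y (Lam a u) = ipX (gamma Y) u by rewrite {1}aY ip_Lam.
rewrite !ipDl !ipNl YL lerD2r.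
by have := ip_Lam_le a Z u; rewrite tu.
Qed.

(** Every subgradient at [Y] has the norm of [u]. This applies to [U], to [Lam a u] and to their
    midpoint, so they coincide. *)
Lemma subdiff_gamma_unique a u U : A_of gamma Lam Y a ->
  subdiff ipX psi (gamma Y) u -> subdiff ipH (psi \o gamma) Y U ->
  U = Lam a u.
Proof.
move=> aY xu YU; have YL := subdiff_Lam aY xu.
have norm W : subdiff ipH (psi \o gamma) Y W -> ipH W W = ipX u u.
  by move=> /subdiff_gamma[xW _]; rewrite -ip_gamma_diag (psi_smooth xW xu).
apply: (@midpoint_same_norm _ _ ipH); first by rewrite !norm.
rewrite !norm// => Z; have := YU Z; have := YL Z; rewrite /= psiY.
case: (psi (gamma Z)) => [s| |]//; last by move=> *; exact: leey.
by rewrite -!EFinD !lee_fin !ipE; lra.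
Qed.

Lemma grad_gamma a : A_of gamma Lam Y a ->
  grad ipH (psi \o gamma) Y = Lam a (grad ipX psi (gamma Y)).
Proof.
move=> aY; rewrite /grad.
have [x0|xN] := pselect (subdiff ipX psi (gamma Y) !=set0).
  have xu := @xgetPex _ 0 _ x0; apply: subdiff_gamma_unique => //.
  apply: xgetPex; exists (Lam a (xget 0 (subdiff ipX psi (gamma Y)))).
  exact: subdiff_Lam.
(* Without subgradients both gradients take the default value 0, which [Lam a] preserves. *)
rewrite !xgetPN ?linear0// => u; first by move=> xu; apply: xN; exists u.
by move=> /subdiff_gamma[xu _]; apply: xN; exists (gamma u).
Qed.

(* The midpoint M of Y and Lam b (gamma Y) satisfies gamma M = gamma Y, because
   u is also a subgradient of psi at gamma M; hence M is as long as the two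
   endpoints, which must coincide. *)
Lemma Lam_subgradient_inj a b u : A_of gamma Lam Y a ->
  subdiff ipX psi (gamma Y) u -> Lam a u = Lam b u -> A_of gamma Lam Y b.
Proof.
move=> aY xu ab; have tu := tau_subgradient (tau_gamma Y) psiY xu.
set x := gamma Y in xu *; pose Y' := Lam b x.
have gY' : gamma Y' = x by rewrite gamma_Lam tau_gamma.
pose M := 2^-1 *: (Y + Y'); pose m := gamma M.
have [c ME] := Lam_gamma M.
have mmaj v : ipX m v <= ipX x (tau v).
  rewrite -(ip_Lam c) -ME /M ipZl ipDl.
  have := ip_Lam_le c Y v; have := ip_Lam_le c Y' v; rewrite gY' -/x; lra.
(* The sublevel set of [psi] at height [r] is convex and contains the orbit of [x], so majorization
   puts [m] in it. *)
have psim : (psi m <= r%:E)%E.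
  apply: (majorized_mem mmaj (convex_sublevel psi_proper.1 psi_convex (r := r))).
  by move=> s /=; rewrite psi_inv psiY.
(* Together with [psim], this turns the subgradient inequality of [u] at [x] into the one at [m].
   The equality [Lam a u = Lam b u] evaluates the half of [M] that comes from [Y]. *)
have mu : ipX x u <= ipX m u.
  rewrite -{2}tu; apply: le_trans (ip_Lam_le b M u).
  rewrite /M ipZl ipDl -{1}ab [Y in ipH Y _]aY !ip_Lam -/x; lra.
have [r' psimE] := fin_of_lty psi_proper.1 (le_lt_trans psim (ltry r)).
have mxE : m = x.
  apply/esym; apply: (subdiff_inj psi_proper.1 psi_convex psi_esc psiY xu).
  move=> z; apply: le_trans (xu z); move: psim.
  by rewrite psimE psiY -!EFinD !lee_fin !ipE; lra.
apply: (@midpoint_same_norm _ _ ipH).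
  by rewrite -[in LHS]ip_gamma_diag -[in RHS]ip_gamma_diag gY'.
by rewrite -[in leRHS]ip_gamma_diag -/Y' -/M -/m mxE ip_gamma_diag.
Qed.

End AtPoint.

(** Balls transfer both ways: [Lam a] is an isometry, and [gamma] is 1-Lipschitz because it
    preserves norms and satisfies [D]. *)
Lemma interior_gamma Y :
  Defs.interior ipH (effdom (psi \o gamma)) Y <->
  Defs.interior ipX (effdom psi) (gamma Y).
Proof.
split=> -[e [e0 Ye]]; exists e; split => //.
  move=> y yY; have [a YE] := Lam_gamma Y; have := Ye (Lam a y).
  by rewrite /effdom /= psi_gamma_Lam {1}YE -linearB Lam_vnorm; apply.
move=> Z ZY; apply: Ye; apply: le_lt_trans ZY; apply: ler_wsqrtr.
have := ip_gamma_diag Z; have := ip_gamma_diag Y; have := ip_gamma Z Y.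
rewrite !ipE (ip_sym ipH Y Z) (ip_sym ipX (gamma Y)); lra.
Qed.

Lemma interior_fin x : Defs.interior ipX (effdom psi) x -> exists r, psi x = r%:E.
Proof.
move=> [e [e0 xe]]; apply: (fin_of_lty psi_proper.1); apply: xe.
by rewrite subrr /vnorm ip0l sqrtr0.
Qed.

Lemma grad_subdiff x : Defs.interior ipX (effdom psi) x ->
  subdiff ipX psi x (grad ipX psi x).
Proof. by move=> xi; apply: xgetPex; exact: subdiff_interior. Qed.

Lemma tau_grad Y : Defs.interior ipX (effdom psi) (gamma Y) ->
  tau (grad ipX psi (gamma Y)) = grad ipX psi (gamma Y).
Proof.
move=> xi; have [r psiY] := interior_fin xi.
exact: tau_subgradient (tau_gamma Y) psiY (grad_subdiff xi).
Qed.

Lemma Bregman_Lam a Y z : A_of gamma Lam Y a ->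
  Bregman ipH (psi \o gamma) (Lam a z) Y = Bregman ipX psi z (gamma Y).
Proof.
move=> aY; rewrite /Bregman (asbool_equiv_eq (interior_gamma Y)).
case: asboolP => // xi; have [r psiY] := interior_fin xi.
rewrite (grad_gamma psiY aY) /= psi_gamma_Lam; congr (_ - _%:E)%E.
by rewrite {1}aY -linearB ip_Lam.
Qed.

Lemma Bregman_gamma_le Y Z :
  (Bregman ipX psi (gamma Z) (gamma Y) <= Bregman ipH (psi \o gamma) Z Y)%E.
Proof.
rewrite /Bregman (asbool_equiv_eq (interior_gamma Y)).
case: asboolP => // xi; have [r psiY] := interior_fin xi.
have [a aY] := Lam_gamma Y; rewrite (grad_gamma psiY aY) /=.
apply: leeD2l; rewrite lee_fin lerN2 !ipDl !ipNl.
have -> : ipH Y (Lam a (grad ipX psi (gamma Y))) = ipX (gamma Y) (grad ipX psi (gamma Y)).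
  by rewrite {1}aY ip_Lam.
by rewrite lerD2r; apply: le_trans (ip_Lam_le a _ _) _; rewrite tau_grad.
Qed.

(** * Envelopes and proximal points *)

Section Prox.
Variable phi : X -> \bar R.
Hypothesis phi_inv : S_invariant G phi.
Hypothesis phi_proper : proper_fun phi.
Variable Y : H.
Local Notation x := (gamma Y).
Local Notation u := (grad ipX psi (gamma Y)).
Local Notation ProxH := (Prox ipH (phi \o gamma) (psi \o gamma) Y).
Local Notation ProxX := (Prox ipX phi psi x).

Lemma phi_gamma_Lam a z : phi (gamma (Lam a z)) = phi z.
Proof. by rewrite gamma_Lam; have [s _ <-] := tau_orbit z; rewrite phi_inv. Qed.

Lemma objective_Lam a z : A_of gamma Lam Y a ->
  ((phi \o gamma) (Lam a z) + Bregman ipH (psi \o gamma) (Lam a z) Y =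
   phi z + Bregman ipX psi z x)%E.
Proof. by move=> aY; rewrite Bregman_Lam //= phi_gamma_Lam. Qed.

Lemma objective_gamma_le Z :
  (phi (gamma Z) + Bregman ipX psi (gamma Z) x <=
   (phi \o gamma) Z + Bregman ipH (psi \o gamma) Z Y)%E.
Proof. by apply: leeD2l; exact: Bregman_gamma_le. Qed.

Lemma env_gamma :
  env ipH (phi \o gamma) (psi \o gamma) Y = env ipX phi psi x.
Proof.
have [a aY] := Lam_gamma Y; apply/le_anti/andP; split.
  apply: le_ereal_inf_tmp => _ [z _ <-]; apply: ereal_inf_lbound.
  by exists (Lam a z) => //; exact: objective_Lam.
apply: le_ereal_inf_tmp => _ [Z _ <-].
apply: le_trans (objective_gamma_le Z).
by apply: ereal_inf_lbound; exists (gamma Z).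
Qed.

Lemma Prox_Lam a z : A_of gamma Lam Y a -> ProxH (Lam a z) <-> ProxX z.
Proof.
move=> aY; have := env_gamma; rewrite /env => envE.
split=> -[inf_lty zmin]; split=> [|y].
- by rewrite -envE.
- by have := zmin (Lam a y); rewrite !objective_Lam.
- by rewrite [X in (X < _)%E]envE.
- rewrite objective_Lam//; exact: le_trans (zmin (gamma y)) (objective_gamma_le y).
Qed.

(** Outside the interior the objective is identically +oo, which the clause on the infimum in
    [argmin] excludes; otherwise a minimizer has a finite value. *)
Lemma ProxX_fin z : ProxX z ->
  [/\ Defs.interior ipX (effdom psi) x, exists p, phi z = p%:E &
      exists q, psi z = q%:E].
Proof.
move=> [/ereal_inf_lt[_ [y _ <-] ylty] /(_ y)] /le_lt_trans/(_ ylty) {y ylty}.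
rewrite /Bregman; case: asboolP => [xi|_].
  have [r ->] := interior_fin xi.
  case: (phi z) (phi_proper.1 z) => [p| |] //; case: (psi z) (psi_proper.1 z) => [q| |] //.
  by split => //; [exists p | exists q].
by case: (phi z) (phi_proper.1 z).
Qed.

Lemma ProxH_gamma Z : ProxH Z -> ProxX (gamma Z).
Proof.
have [a aY] := Lam_gamma Y => -[inf_lty Zmin]; split => [|y].
  by have := env_gamma; rewrite /env => <-.
apply: le_trans (objective_gamma_le Z) _.
by rewrite -(objective_Lam _ aY).
Qed.

(** The competitor [Lam a (gamma Z)] has the same values of [phi] and [psi] after [gamma], so
    minimality of [Z] compares only linear terms and reverses the trace inequality. *)
Lemma ProxH_ip a Z : A_of gamma Lam Y a -> ProxH Z ->
  ipH Z (Lam a u) = ipX (gamma Z) u.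
Proof.
move=> aY PZ; have [xi [p phiZ] [q psiZ]] := ProxX_fin (ProxH_gamma PZ).
have [r psiY] := interior_fin xi.
apply/le_anti/andP; split.
  by apply: le_trans (ip_Lam_le a _ _) _; rewrite tau_grad.
have := PZ.2 (Lam a (gamma Z)); rewrite objective_Lam// /Bregman.
rewrite (asbool_equiv_eq (interior_gamma Y)) asboolT// (grad_gamma psiY aY) /=.
rewrite phiZ psiZ psiY -!EFinB -!EFinD lee_fin !ipDl !ipNl.
have -> : ipH Y (Lam a u) = ipX x u by rewrite {1}aY ip_Lam.
by lra.
Qed.

(** Stated for arbitrary [Z], so that it also covers convex combinations of proximal points before
    these are known to be proximal. *)
Lemma A_of_joint Z : Defs.interior ipX (effdom psi) x ->
  (exists2 a, A_of gamma Lam Y a & ipH Z (Lam a u) = ipX (gamma Z) u) ->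
  exists b, A_of gamma Lam Y b /\ Z = Lam b (gamma Z).
Proof.
move=> xi [a aY Zu]; have [r psiY] := interior_fin xi.
have gu : gamma (Lam a u) = u by rewrite gamma_Lam tau_grad.
have [b [Zb ub]] : exists b, Z = Lam b (gamma Z) /\ Lam a u = Lam b (gamma (Lam a u)).
  by apply: simultaneous_decomposition; rewrite gu.
exists b; split => //; rewrite gu in ub.
exact: (Lam_subgradient_inj psiY aY (grad_subdiff xi)).
Qed.

Lemma ProxHP Z :
  ProxH Z <-> ProxX (gamma Z) /\ exists a, Y = Lam a x /\ Z = Lam a (gamma Z).
Proof.
split=> [PZ|[PZ [a [aY Za]]]]; last by rewrite Za Prox_Lam.
split; first exact: ProxH_gamma.
have [xi _ _] := ProxX_fin (ProxH_gamma PZ).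
have [a aY] := Lam_gamma Y; apply: A_of_joint => //.
by exists a => //; exact: ProxH_ip.
Qed.

Lemma ProxH_image :
  ProxH = [set Lam a z | z in ProxX & a in A_of gamma Lam Y].
Proof.
apply/seteqP; split=> [Z /ProxHP[PZ [a [aY Za]]]|_ [z Pz [a aY <-]]].
  by exists (gamma Z) => //; exists a.
exact/(Prox_Lam _ aY).
Qed.

(* phi and psi are constant on the orbit of z, so minimality of z there says that
   it maximizes the linear term. *)
Lemma ProxX_orbit z s : ProxX z ->
  ipX (act G s z) u <= ipX z u /\ (ipX (act G s z) u = ipX z u -> ProxX (act G s z)).
Proof.
move=> Pz; have [xi [p phiz] [q psiz]] := ProxX_fin Pz.
have [r psiY] := interior_fin xi.
have objE y : phi y = p%:E -> psi y = q%:E -> (phi y + Bregman ipX psi y x)%E =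
    (p + (q - r - (ipX y u - ipX x u)))%:E.
  by move=> phiy psiy; rewrite /Bregman asboolT// phiy psiy psiY !ipDl !ipNl.
have zobj := objE _ phiz psiz.
have szobj : (phi (act G s z) + Bregman ipX psi (act G s z) x)%E = _ :=
  objE (act G s z) (etrans (phi_inv s z) phiz) (etrans (psi_inv s z) psiz).
split=> [|szu].
  by have := Pz.2 (act G s z); rewrite zobj szobj lee_fin; lra.
split=> [|y]; first exact: Pz.1.
by rewrite szobj szu -zobj; exact: Pz.2.
Qed.

(* gamma Z is majorized by the same convex combination zbar of gamma Z1 and gamma Z2,
   and has the same inner product with u; so it is a convex combination of those
   points of the orbit of zbar that maximize the inner product with u. *)
Lemma convex_ProxH : convex_set ProxX -> convex_set ProxH.
Proof.
move=> cP Z1 Z2 t P1 P2 t01; have /andP[t0 t1] := t01.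
set Z := _ + _; pose m := gamma Z.
have [a aY] := Lam_gamma Y; have [c Zc] := Lam_gamma Z.
have PX1 := ProxH_gamma P1; have PX2 := ProxH_gamma P2.
have [xi _ _] := ProxX_fin PX1.
pose zbar := (1 - t) *: gamma Z1 + t *: gamma Z2.
have Pzbar : ProxX zbar by exact: cP.
have mmaj v : ipX m v <= ipX zbar (tau v).
  rewrite -(ip_Lam c) -Zc !ipDl !ipZl.
  have := ip_Lam_le c Z1 v; have := ip_Lam_le c Z2 v; nra.
have Zu : ipH Z (Lam a u) = ipX zbar u by rewrite !ipDl !ipZl !ProxH_ip.
have mu : ipX m u = ipX zbar u.
  apply/le_anti/andP; split; first by have := mmaj u; rewrite tau_grad.
  by rewrite -Zu; apply: le_trans (ip_Lam_le a _ _) _; rewrite tau_grad.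
have [b [bY Zb]] : exists b, A_of gamma Lam Y b /\ Z = Lam b (gamma Z).
  by apply: A_of_joint => //; exists a => //; rewrite Zu -mu.
(* An open half-space glued to the proximal points on its boundary: it contains the whole orbit of
   [zbar], hence [m], and [m] lies on the boundary by [mu]. *)
pose C := [set w | ipX w u < ipX zbar u \/ ipX w u = ipX zbar u /\ ProxX w].
have cC : convex_set C.
  move=> w1 w2 s C1 C2 /andP[s0 s1].
  have [->|sN0] := eqVneq s 0; first by rewrite subr0 scale1r scale0r addr0.
  have [->|sN1] := eqVneq s 1; first by rewrite subrr scale1r scale0r add0r.
  have s0' : 0 < s by rewrite lt_neqAle eq_sym sN0.
  have s1' : s < 1 by rewrite lt_neqAle sN1.
  have s1'' : 0 < 1 - s by rewrite subr_gt0.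
  rewrite /C /= ipDl !ipZl.
  case: C1 => [l1|[e1 p1]]; case: C2 => [l2|[e2 p2]].
  - left; have m1 := mulr_gt0 s1'' (etrans (subr_gt0 _ _) l1).
    by have m2 := mulr_gt0 s0' (etrans (subr_gt0 _ _) l2); lra.
  - by left; have m1 := mulr_gt0 s1'' (etrans (subr_gt0 _ _) l1); rewrite e2; lra.
  - by left; have m2 := mulr_gt0 s0' (etrans (subr_gt0 _ _) l2); rewrite e1; lra.
  - right; split; first by rewrite e1 e2; ring.
    by apply: cP => //; rewrite s0 s1.
have : C m.
  apply: (majorized_mem mmaj cC) => s.
  have [le_u eq_u] := ProxX_orbit s Pzbar.
  have [e|ne] := eqVneq (ipX (act G s zbar) u) (ipX zbar u).
    by right; split => //; exact: eq_u.
  by left; rewrite lt_neqAle ne.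
case=> [|[_ Pm]]; first by rewrite mu ltxx.
by rewrite Zb; apply/(Prox_Lam _ bY).
Qed.

Lemma convex_Prox : convex_set ProxH <-> convex_set ProxX.
Proof.
split=> [cP z1 z2 t P1 P2 t01|]; last exact: convex_ProxH.
have [a aY] := Lam_gamma Y; apply/(Prox_Lam _ aY).
rewrite linearD !linearZ.
by apply: cP => //; apply/(Prox_Lam _ aY).
Qed.

(** Forward, [Lam a] is injective. Backward, [ProxH] is convex by [convex_ProxH], and all its points
    have the norm of [z], so strict convexity of the norm leaves only one. *)
Lemma singleton_Prox : is_singleton ProxH <-> is_singleton ProxX.
Proof.
have [a aY] := Lam_gamma Y; split=> -[z Pz].
  have PZ : ProxH z by rewrite Pz.
  exists (gamma z); apply/seteqP; split=> [y Py|_ ->]; last exact: ProxH_gamma.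
  have h w : ProxX w -> Lam a w = z.
    by move=> /(Prox_Lam _ aY); rewrite Pz.
  have e : Lam a y = Lam a (gamma z) by rewrite !h//; exact: ProxH_gamma.
  apply: (@ip_sub_eq0 _ _ ipX).
  by rewrite -(ip_Lam a) linearB e subrr ip0l.
have Pzz : ProxX z by rewrite Pz.
have PL : ProxH (Lam a z) by apply/(Prox_Lam _ aY).
have gz W : ProxH W -> gamma W = z by move=> /ProxH_gamma; rewrite Pz.
have cP : convex_set ProxH.
  apply: convex_ProxH; rewrite Pz => _ _ t -> -> _ /=.
  by rewrite -scalerDl subrK scale1r.
exists (Lam a z); apply/seteqP; split=> [W PW|_ ->//].
have h01 : 0 <= (2^-1 : R) <= 1 by lra.
have PM := cP _ _ _ PW PL h01.
have norm V : ProxH V -> ipH V V = ipX z z by move=> /gz <-; rewrite ip_gamma_diag.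
apply: (@midpoint_same_norm _ _ ipH); first by rewrite !norm.
rewrite scalerDr norm//.
have -> : 2^-1 *: W = (1 - 2^-1) *: W by congr (_ *: _); lra.
by rewrite norm.
Qed.

End Prox.
End Legendre.
End SpectralDecomposition.

Theorem theorem6p2 (R : realType) (H X : vectType R)
  (ipH : innerProd H) (ipX : innerProd X) (S : Type) (G : isomAction ipX S)
  (gamma : H -> X) (A : Type) (Lam : A -> {linear X -> H})
  (SDS : spectral_decomposition_system ipH G gamma Lam)
  (phi psi : X -> \bar R)
  (phi_proper : proper_fun phi) (phi_inv : S_invariant G phi)
  (psi_Gamma0 : Gamma0 ipX psi) (psi_inv : S_invariant G psi)
  (psi_Legendre : Legendre ipX psi)
  (hdom : effdom phi `&` effdom psi !=set0)
  (Y : H) :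
  [/\ (* (i) *)
      env ipH (phi \o gamma) (psi \o gamma) Y = env ipX phi psi (gamma Y),
      (* (ii) *)
      (forall Z : H, Prox ipH (phi \o gamma) (psi \o gamma) Y Z <->
         (Prox ipX phi psi (gamma Y) (gamma Z) /\
          exists a, Y = Lam a (gamma Y) /\ Z = Lam a (gamma Z))),
      (* (iii) *)
      (forall (z : X) (a : A), A_of gamma Lam Y a ->
         (Prox ipH (phi \o gamma) (psi \o gamma) Y (Lam a z) <->
          Prox ipX phi psi (gamma Y) z)),
      (* (iv) *)
      Prox ipH (phi \o gamma) (psi \o gamma) Y =
        [set Lam a z | z in Prox ipX phi psi (gamma Y) & a in A_of gamma Lam Y] &
      (* (v) and (vi) *)
      (convex_set (Prox ipH (phi \o gamma) (psi \o gamma) Y) <->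
         convex_set (Prox ipX phi psi (gamma Y))) /\
      (is_singleton (Prox ipH (phi \o gamma) (psi \o gamma) Y) <->
         is_singleton (Prox ipX phi psi (gamma Y)))].
Proof.
case: SDS => Lam_vnorm [tau [tau_inv tau_orbit gamma_Lam]] Lam_gamma ip_gamma.
have [[psi_proper [_ psi_convex]] [psi_smooth psi_esc]] := psi_Legendre.
split.
- exact: env_gamma.
- by move=> Z; exact: ProxHP.
- by move=> z a aY; exact: Prox_Lam.
- exact: ProxH_image.
- by split; [exact: convex_Prox | exact: singleton_Prox].
Qed.
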